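(* Let $\Lambda\colon\mathbb{R}\to[0,1]$ and $\mathcal R:=\{x\in\mathbb{R}\mid Q_\Lambda^+(B_{x,0})=x\}$. The following are equivalent: (a) $\Lambda$ is right lower semicontinuous, i.e. $\liminf_{y\downarrow x}\Lambda(y)\ge\Lambda(x)$ for all $x\in\mathbb{R}$. (b) For all $x\in\mathbb{R}$: $\Lambda(x)=\inf\{1-p\mid p\in[0,1],\ Q_\Lambda^+(B_{x,p})=x\}$ if $x\in\mathcal R$, and $\Lambda(x)=1$ if $x\notin\mathcal R$. (c) For all $x\in\mathbb{R}$: $\Lambda(x)=\inf\{F(x)\mid F\in\mathcal M,\ Q_\Lambda^+(F)=x\}$ if $x\in\mathcal R$, and $\Lambda(x)=1$ if $x\notin\mathcal R$.
   Context: $\mathcal M$ is the set of cumulative distribution functions on $\mathbb{R}$. For $F\in\mathcal M$, $Q_\Lambda^+(F):=\inf\{x\in\mathbb{R}\mid F(x)>\Lambda(x)\}\in[-\infty,\infty]$, with $\inf\varnothing=\infty$. For $x\in\mathbb{R}$ and $p\in[0,1]$, $B_{x,p}:=(1-p)\mathbf 1_{[x,x+1)}+\mathbf 1_{[x+1,\infty)}\in\mathcal M$. *)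

(* Defs.v *)
From HB Require Import structures.
From mathcomp Require Import all_boot all_order all_algebra.
From mathcomp Require Import all_classical all_reals all_analysis.

Set Implicit Arguments.
Unset Strict Implicit.
Unset Printing Implicit Defensive.

Import Order.TTheory GRing.Theory Num.Theory.
Import numFieldNormedType.Exports.

Local Open Scope classical_set_scope.
Local Open Scope ring_scope.

Notation CDF R := (cumulativeBounded (0 : R) (1 : R)).

Definition Lambda_quantile (R : realType) (Lambda : R -> R) (F : CDF R) : \bar R :=
  ereal_inf (EFin @` [set x : R | F x > Lambda x]).

(* p ranges over {i01 R}, the elements of R in [0, 1], so that two_point x p is
   a CDF without further hypotheses. *)
Definition two_point (R : realType) (x : R) (p : {i01 R}) (y : R) : R :=
  (1 - p%:num) * \1_(`[x, x + 1[ : set R) y + \1_(`[x + 1, +oo[ : set R) y.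

Section two_point_CDF.
Context {R : realType} (x : R) (p : {i01 R}).

Lemma two_pointE (y : R) : two_point x p y =
  if y < x then 0 else if y < x + 1 then 1 - p%:num else 1.
Proof.
rewrite /two_point !indicE !mem_setE !in_itv /= andbT.
case: (ltP y x) => yx.
  have yx1 : y < x + 1 by rewrite (lt_le_trans yx)// lerDl.
  by rewrite leNgt yx1 /= mulr0 addr0.
by case: (ltP y (x + 1)) => yx1; rewrite ?mulr1 ?addr0 ?mulr0 ?add0r.
Qed.

Let two_point_nd : nondecreasing (two_point x p).
Proof.
move=> y z yz; rewrite !two_pointE.
have p0 : 0 <= p%:num :> R by [].
have p1 : p%:num <= 1 :> R by [].
case: (ltP y x) => yx.
  case: ifP => // _; case: ifP => // _; by rewrite subr_ge0.
rewrite (ltNge z) (le_trans yx yz) /=.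
case: (ltP y (x + 1)) => yx1; last by rewrite ltNge (le_trans yx1 yz).
by case: ifP => // _; rewrite lerBlDr lerDl.
Qed.

Let two_point_rc : right_continuous (two_point x p).
Proof.
move=> y; apply: cvg_near_cst; rewrite !two_pointE.
case: (ltP y x) => yx.
  near=> z; rewrite two_pointE.
  have zx : z < x by near: z; exact: nbhs_right_lt.
  by rewrite zx.
case: (ltP y (x + 1)) => yx1; near=> z; rewrite two_pointE.
  have yz : y <= z by near: z; exact: nbhs_right_ge.
  have zx1 : z < x + 1 by near: z; exact: nbhs_right_lt.
  by rewrite ltNge (le_trans yx yz) zx1.
have yz : y <= z by near: z; exact: nbhs_right_ge.
by rewrite ltNge (le_trans yx yz) /= ltNge (le_trans yx1 yz).
Unshelve. all: by end_near. Qed.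

HB.instance Definition _ :=
  isCumulative.Build R _ R (two_point x p) two_point_nd two_point_rc.

Let two_point_Ny : two_point x p @ -oo --> (0 : R).
Proof.
apply: cvg_near_cst; near=> z; rewrite two_pointE.
have zx : z < x by near: z; apply: nbhs_ninfty_lt; exact: num_real.
by rewrite zx.
Unshelve. all: by end_near. Qed.

Let two_point_y : two_point x p @ +oo --> (1 : R).
Proof.
apply: cvg_near_cst; near=> z; rewrite two_pointE.
have xz : x + 1 <= z by near: z; apply: nbhs_pinfty_ge; exact: num_real.
have xz' : x <= z by rewrite (le_trans _ xz)// lerDl.
by rewrite ltNge xz' ltNge xz.
Unshelve. all: by end_near. Qed.

HB.instance Definition _ :=
  isCumulativeBounded.Build R 0 1 (two_point x p) two_point_Ny two_point_y.

End two_point_CDF.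

Definition reachable (R : realType) (Lambda : R -> R) : set R :=
  [set x | Lambda_quantile Lambda (two_point x 0%:i01) = x%:E].

Definition right_lower_semicontinuous (R : realType) (f : R -> R) : Prop :=
  forall x : R, ((f x)%:E <= limf_einf (EFin \o f) x^'+)%E.

(* Main.v *)
(* Say that Lambda dips below q on the right of x when every [x, z[ with z > x
   contains a point where Lambda is < q. Right lower semicontinuity means that
   Lambda x <= q for all such q, and Q(B_{x,p}) = x means that Lambda dips below
   1 - p on the right of x; moreover Lambda always dips below every
   q > Lambda x. *)
Require Import Defs.
From mathcomp Require Import all_boot all_order all_algebra.
From mathcomp Require Import all_classical all_reals all_analysis.

Import Order.TTheory GRing.Theory Num.Theory.
Import numFieldNormedType.Exports.

Local Open Scope classical_set_scope.
Local Open Scope ring_scope.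

Definition dips_below_on_right {R : realType} (f : R -> R) (x q : R) : Prop :=
  forall z, x < z -> exists2 y, x <= y < z & f y < q.

Lemma dips_below_on_right_le {R : realType} (f : R -> R) (x q r : R) :
  q <= r -> dips_below_on_right f x q -> dips_below_on_right f x r.
Proof.
by move=> qr dip z /dip[y xyz fyq]; exists y => //; exact: lt_le_trans qr.
Qed.

(** If [q < f x], the liminf bound makes [f] exceed [q] on some []x, x + e[], which leaves no room
    for a dip below [q]. Conversely, [f] cannot dip below [f x - e], so [f x - e] bounds [f] from
    below on some []x, z[]. *)
Lemma right_lower_semicontinuousP {R : realType} (f : R -> R) :
  right_lower_semicontinuous f <->
  (forall x q, dips_below_on_right f x q -> f x <= q).
Proof.
split=> [rlsc x q dip|fle x].
  rewrite leNgt; apply/negP => qfx.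
  have : (q%:E < limf_einf (EFin \o f) x^'+)%E.
    by apply: lt_le_trans (rlsc x); rewrite lte_fin.
  rewrite limf_einfE => /ereal_sup_gt[_ [V [e /= e0 xeV] <-]] qV.
  have [|y /andP[xy yxe] fyq] := dip (x + e); first by rewrite ltrDl.
  (* A dip may occur at [x] itself, which the filter [x^'+] does not see; there [q < f x] gives the
     contradiction directly. *)
  move: xy; rewrite le_eqVlt => /predU1P[xy|xy].
    by move: fyq; rewrite -xy => /(lt_trans qfx); rewrite ltxx.
  have Vy : V y.
    by apply: xeV => //=; rewrite distrC gtr0_norm ?subr_gt0// ltrBlDl.
  have : (ereal_inf ((EFin \o f) @` V) <= (f y)%:E)%E.
    by apply: ereal_inf_lbound; exists y.
  by move=> /(lt_le_trans qV); rewrite lte_fin => /(lt_trans fyq); rewrite ltxx.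
apply/lee_subgt0Pr => e e0; rewrite limf_einfE -EFinB.
have /existsNP[z /not_implyP[xz ndip]] : ~ dips_below_on_right f x (f x - e).
  by move=> /fle; rewrite lerBrDr gerDl leNgt e0.
have xzV : \forall y \near x^'+, `]x, z[%classic y.
  apply: filterS2 (nbhs_right_gt x) (nbhs_right_lt xz) => y xy yz.
  by rewrite /= in_itv /= xy.
apply: le_ereal_sup_tmp; exists (ereal_inf ((EFin \o f) @` `]x, z[%classic)).
  by exists `]x, z[%classic.
apply: le_ereal_inf_tmp => _ [y /= + <-]; rewrite in_itv => /andP[xy yz].
rewrite lee_fin leNgt; apply/negP => fy.
by apply: ndip; exists y => //; rewrite (ltW xy).
Qed.

Lemma ereal_inf_EFin_eqP {R : realType} (A : set R) (x : R) :
  ereal_inf (EFin @` A) = x%:E <->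
  lbound A x /\ (forall z, x < z -> exists2 y, A y & y < z).
Proof.
split=> [infA|[lbx adhx]].
  split=> [y Ay|z xz].
    by rewrite -lee_fin -infA; apply: ereal_inf_lbound; exists y.
  have : (ereal_inf (EFin @` A) < z%:E)%E by rewrite infA lte_fin.
  by move=> /ereal_inf_lt[_ [y Ay <-]]; rewrite lte_fin; exists y.
apply/eqP; rewrite eq_le; apply/andP; split.
  apply/lee_addgt0Pr => e e0.
  have [|y Ay yxe] := adhx (x + e); first by rewrite ltrDl.
  by apply: ge_ereal_inf; exists y%:E; [exists y|rewrite -EFinD lee_fin ltW].
by apply: le_ereal_inf_tmp => _ [y Ay <-]; rewrite lee_fin lbx.
Qed.

Lemma Lambda_quantileP {R : realType} (Lambda : R -> R) (F : CDF R) (x : R) :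
  Lambda_quantile Lambda F = x%:E <->
  (forall y, Lambda y < F y -> x <= y) /\
  (forall z, x < z -> exists2 y, Lambda y < F y & y < z).
Proof. exact: ereal_inf_EFin_eqP. Qed.

Section bounded_Lambda.
Context {R : realType} (Lambda : R -> R).
Hypothesis Lambda01 : forall x : R, 0 <= Lambda x <= 1.

(** Left of [x] the two-point CDF is [0 <= Lambda], so nothing there counts; on [[x, x + 1[] it is
    constantly [1 - p]. *)
Lemma two_point_quantileP (x : R) (p : {i01 R}) :
  Lambda_quantile Lambda (two_point x p) = x%:E <->
  dips_below_on_right Lambda x (1 - p%:num).
Proof.
have atom y : x <= y -> y < x + 1 -> two_point x p y = 1 - p%:num.
  by move=> xy yx1; rewrite two_pointE ltNge xy /= yx1.
have lbx y : Lambda y < two_point x p y -> x <= y.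
  rewrite two_pointE; case: (ltP y x) => // _.
  by have /andP[L0 _] := Lambda01 y; rewrite ltNge L0.
rewrite Lambda_quantileP; split=> [[_ adhx] z xz|dip].
  (* Capping at [x + 1] keeps [y] on the plateau of height [1 - p]. *)
  have [|y Ly] := adhx (Num.min z (x + 1)); first by rewrite lt_min xz ltrDl /=.
  rewrite lt_min => /andP[yz yx1]; exists y; first by rewrite (lbx y).
  by rewrite -(atom y)// lbx.
split=> // z xz.
have [|y /andP[xy]] := dip (Num.min z (x + 1)); first by rewrite lt_min xz ltrDl /=.
by rewrite lt_min => /andP[yz yx1]; rewrite -(atom y)//; exists y.
Qed.

Lemma reachableP (x : R) :
  reachable Lambda x <-> dips_below_on_right Lambda x 1.
Proof. by rewrite /reachable /= two_point_quantileP subr0. Qed.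

(** If [Lambda x < 1], then [x] itself is a point of every [[x, z[] where [Lambda] is below 1. *)
Lemma eq1_not_reachable (x : R) : ~ reachable Lambda x -> Lambda x = 1.
Proof.
move=> /reachableP/existsNP[z /not_implyP[xz ndip]].
have /andP[_ L1] := Lambda01 x; apply/eqP; rewrite eq_le L1 leNgt /=.
by apply/negP => Lx; apply: ndip; exists x => //; rewrite lexx.
Qed.

(** The choice is [p = 1 - q]; a dip below [q] forces [0 <= q] since [Lambda] is nonnegative. *)
Lemma dips_below_on_right_two_point (x q : R) :
  dips_below_on_right Lambda x q -> q <= 1 -> exists2 p : {i01 R},
    Lambda_quantile Lambda (two_point x p) = x%:E & 1 - p%:num = q.
Proof.
move=> dip q1.
have q0 : 0 <= q.
  have [|y _ Lyq] := dip (x + 1); first by rewrite ltrDl.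
  by have /andP[L0 _] := Lambda01 y; rewrite ltW// (le_lt_trans L0).
have p0 : 0 <= 1 - q by rewrite subr_ge0.
have p1 : 1 - q <= 1 by rewrite gerBl.
have pE : 1 - (Itv01 p0 p1)%:num = q by rewrite /= subKr.
by exists (Itv01 p0 p1) => //; apply/two_point_quantileP; rewrite pE.
Qed.

(** This is the way back to (a) from either infimum formula: levels [q <= 1] come from two-point
    CDFs, and larger ones bound [Lambda] trivially. *)
Lemma lower_bound_right_lower_semicontinuous :
  (forall x (p : {i01 R}), Lambda_quantile Lambda (two_point x p) = x%:E ->
     Lambda x <= 1 - p%:num) ->
  right_lower_semicontinuous Lambda.
Proof.
move=> lb; apply/right_lower_semicontinuousP => x q dip.
have [q1|/ltW q1] := leP q 1; last first.
  by apply: le_trans q1; case/andP: (Lambda01 x).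
by have [p Qp <-] := dips_below_on_right_two_point _ _ dip q1; exact: lb.
Qed.

(* By right continuity, the points y right of x with Lambda y < F y given by the
   quantile equation satisfy F y < F x + e. *)
Lemma le_quantile_value (F : CDF R) (x : R) :
  right_lower_semicontinuous Lambda ->
  Lambda_quantile Lambda F = x%:E -> Lambda x <= F x.
Proof.
move=> /right_lower_semicontinuousP rlsc /Lambda_quantileP[lbx adhx].
apply/ler_addgt0Pr => e e0; apply: rlsc => z xz.
have : \forall y \near x^'+, F y < F x + e.
  apply: (cvgr_lt (F x)); last by rewrite ltrDl.
  exact: cumulative_is_right_continuous.
move=> [d /= d0 xdF].
have [|y Ly] := adhx (Num.min z (x + d)); first by rewrite lt_min xz ltrDl.
rewrite lt_min => /andP[yz yxd]; have xy := lbx _ Ly.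
exists y; first by rewrite xy.
apply: (lt_trans Ly); move: xy; rewrite le_eqVlt => /predU1P[<-|xy].
  by rewrite ltrDl.
by apply: xdF => //=; rewrite distrC gtr0_norm ?subr_gt0// ltrBlDl.
Qed.

Lemma two_point_inf_le (x : R) : reachable Lambda x ->
  (ereal_inf [set (1 - p%:num)%:E | p in [set p : {i01 R} |
     Lambda_quantile Lambda (two_point x p) = x%:E]] <= (Lambda x)%:E)%E.
Proof.
move=> /reachableP dip1; apply/lee_addgt0Pr => e e0; rewrite -EFinD.
(* The level is capped at 1 so that it has the form [1 - p]. Reachability handles the capped case;
   otherwise [x] is itself a dip below [Lambda x + e]. *)
have dip : dips_below_on_right Lambda x (Num.min 1 (Lambda x + e)).
  have [//|_] := leP 1 (Lambda x + e).
  by move=> z xz; exists x; rewrite ?lexx// ltrDl.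
have [|p Qp pE] := dips_below_on_right_two_point _ _ dip; first by rewrite ge_min lexx.
apply: ge_ereal_inf; exists (1 - p%:num)%:E; first by exists p.
by rewrite lee_fin pE ge_min lexx orbT.
Qed.

(** The value of [two_point x p] at [x] is [1 - p], so the right infimum runs over a subset of the
    left one. *)
Lemma two_point_inf_ge (x : R) :
  (ereal_inf [set (F x)%:E | F in [set F : CDF R |
     Lambda_quantile Lambda F = x%:E]] <=
   ereal_inf [set (1 - p%:num)%:E | p in [set p : {i01 R} |
     Lambda_quantile Lambda (two_point x p) = x%:E]])%E.
Proof.
apply: ereal_inf_le_tmp => _ [p Qp <-]; exists (two_point x p) => //.
by have := two_pointE x p x; rewrite ltxx ltrDl ltr01 => <-.
Qed.

End bounded_Lambda.

Theorem proposition3p5 (R : realType) (Lambda : R -> R)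
    (Lambda01 : forall x : R, 0 <= Lambda x <= 1) :
  [<-> right_lower_semicontinuous Lambda;
       forall x : R,
         (reachable Lambda x ->
            (Lambda x)%:E = ereal_inf
              [set (1 - p%:num)%:E | p in
                 [set p : {i01 R} |
                    Lambda_quantile Lambda (two_point x p) = x%:E]]) /\
         (~ reachable Lambda x -> Lambda x = 1);
       forall x : R,
         (reachable Lambda x ->
            (Lambda x)%:E = ereal_inf
              [set (F x)%:E | F in
                 [set F : CDF R | Lambda_quantile Lambda F = x%:E]]) /\
         (~ reachable Lambda x -> Lambda x = 1)].
Proof.
(* The formulas in (b) and (c) are available only at reachable points, so each two-point CDF with
   quantile [x] must first give reachability of [x]. *)
have reach x (p : {i01 R}) :
    Lambda_quantile Lambda (two_point x p) = x%:E -> reachable Lambda x.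
  move=> /(two_point_quantileP _ Lambda01 _ _) dip; apply/(reachableP _ Lambda01 _).
  by apply: dips_below_on_right_le _ dip; rewrite gerBl.
have inf_ge x : right_lower_semicontinuous Lambda -> ((Lambda x)%:E <=
    ereal_inf [set (F x)%:E | F in [set F : CDF R |
      Lambda_quantile Lambda F = x%:E]])%E.
  move=> rlsc; apply: le_ereal_inf_tmp => _ [F QF <-].
  by rewrite lee_fin le_quantile_value.
tfae=> [rlsc x|two_inf x|cdf_inf].
(* Under (a) both infima are squeezed: [Lambda x] <= CDF infimum <= two-point infimum <=
   [Lambda x]. *)
- split=> [rx|]; last exact: eq1_not_reachable.
  apply/eqP; rewrite eq_le two_point_inf_le// andbT.
  exact: le_trans (inf_ge x rlsc) (two_point_inf_ge _ _).
(* The lower bound over all CDFs rests on (a), which is therefore recovered from (b) before the same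
   squeeze is used. *)
- have rlsc : right_lower_semicontinuous Lambda.
    apply: lower_bound_right_lower_semicontinuous => // y p Qp.
    rewrite -lee_fin (two_inf y).1; last exact: reach Qp.
    by apply: ereal_inf_lbound; exists p.
  split=> [rx|]; last exact: eq1_not_reachable.
  apply/eqP; rewrite eq_le inf_ge//=.
  exact: le_trans (two_point_inf_ge _ _) (two_point_inf_le _ Lambda01 _ rx).
- apply: lower_bound_right_lower_semicontinuous => // x p Qp.
  rewrite -lee_fin (cdf_inf x).1; last exact: reach Qp.
  apply: le_trans (two_point_inf_ge _ _) _.
  by apply: ereal_inf_lbound; exists p.
Qed.
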